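(* Fix an integer $k\ge0$. Let $\{P_m(x,t)\}_{m\ge0}$ be the polynomials defined by $P_0=1$, $P_1=1-x$, and \[ P_m(x,t)=(1-x-x^{k+2}(t-1))P_{m-1}(x,t)-x^2P_{m-2}(x,t)\quad(m\ge2). \] Write $a=1-x-x^{k+2}(t-1)$. Then for $m\ge1$, \[ F_m^{\mathrm{plt}_k}(x,t)=\frac{P_m(x,t)}{P_{m+1}(x,t)}=\cfrac{1}{a-\cfrac{x^2}{a-\cfrac{x^2}{\ddots\,a-\cfrac{x^2}{1-x}}}}, \] a continued fraction in which $a$ appears $m$ times (i.e. with $m+1$ fraction bars), and \[ F^{\mathrm{plt}_k}(x,t)=\cfrac{1}{a-\cfrac{x^2}{a-\cfrac{x^2}{a-\cdots}}}=\frac{1-x-x^{k+2}(t-1)-\sqrt{(1-x-x^{k+2}(t-1))^2-4x^2}}{2x^2}. \]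
   Context: A Motzkin path of length $n$ is a sequence of $n$ steps $U$ ($+1$), $F$ ($0$), $D$ ($-1$) starting and ending at height $0$ and never going below $0$; it has height bounded by $m$ if all heights are at most $m$. A $k$-plateau is an occurrence of the consecutive subword $UF^kD$ (one $U$, then $k$ flat steps, then one $D$); $\mathrm{plt}_k(\mu)$ is the number of $k$-plateaus of $\mu$. With $\mathcal{M}_n^m$ the Motzkin paths of length $n$ with height bounded by $m$ and $\mathcal{M}_n$ all Motzkin paths of length $n$, $F_m^{\mathrm{plt}_k}(x,t)=\sum_n\sum_{\mu\in\mathcal{M}_n^m}t^{\mathrm{plt}_k(\mu)}x^n$ and $F^{\mathrm{plt}_k}(x,t)=\sum_n\sum_{\mu\in\mathcal{M}_n}t^{\mathrm{plt}_k(\mu)}x^n$. An infinite continued fraction denotes the formal power series limit of its finite truncations. *)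

(* Defs.v *)
From HB Require Import structures.
From mathcomp Require Import all_boot all_order all_algebra.
From mathcomp Require Import boolp.

Set Implicit Arguments.
Unset Strict Implicit.
Unset Printing Implicit Defensive.

Import GRing.Theory.
Local Open Scope ring_scope.

(* The ring R[[x]] of formal power series: f : {fps R} coerces to its          *)
(* coefficient function nat -> R. It is a comUnitRingType (f is a unit iff its *)
(* constant coefficient is) and an idomainType whenever R is.                  *)
Record fps (R : Type) := Fps { fps_coef :> nat -> R }.

Notation "{ 'fps' R }" := (fps R) (at level 0, format "{ 'fps'  R }").

HB.instance Definition _ (R : Type) := gen_eqMixin {fps R}.
HB.instance Definition _ (R : Type) := gen_choiceMixin {fps R}.

Lemma fpsP (R : Type) (f g : {fps R}) : f =1 g <-> f = g.
Proof. by split=> [|-> //]; case: f g => f [g] /= /funext ->. Qed.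

Section FpsZmodule.
Variable R : zmodType.
Implicit Types f g : {fps R}.

Definition fps_zero : {fps R} := Fps (fun=> 0).
Definition fps_add f g : {fps R} := Fps (fun n => f n + g n).
Definition fps_opp f : {fps R} := Fps (fun n => - f n).

Fact fps_addA : associative fps_add.
Proof. by move=> f g h; apply/fpsP => n /=; rewrite addrA. Qed.
Fact fps_addC : commutative fps_add.
Proof. by move=> f g; apply/fpsP => n /=; rewrite addrC. Qed.
Fact fps_add0 : left_id fps_zero fps_add.
Proof. by move=> f; apply/fpsP => n /=; rewrite add0r. Qed.
Fact fps_addN : left_inverse fps_zero fps_opp fps_add.
Proof. by move=> f; apply/fpsP => n /=; rewrite addNr. Qed.

HB.instance Definition _ :=
  GRing.isZmodule.Build {fps R} fps_addA fps_addC fps_add0 fps_addN.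

Lemma fps_coef0 n : (0 : {fps R}) n = 0. Proof. by []. Qed.
Lemma fps_coefD f g n : (f + g) n = f n + g n. Proof. by []. Qed.
Lemma fps_coefN f n : (- f) n = - f n. Proof. by []. Qed.
Lemma fps_coefB f g n : (f - g) n = f n - g n. Proof. by []. Qed.
Lemma fps_coef_sum I (r : seq I) (P : pred I) (F : I -> {fps R}) n :
  (\sum_(i <- r | P i) F i) n = \sum_(i <- r | P i) F i n.
Proof. by elim/big_rec2: _ => //= i y1 y2 _ <-. Qed.

End FpsZmodule.

Section FpsRing.
Variable R : comNzRingType.
Implicit Types f g h : {fps R}.

Definition fps_mul f g : {fps R} :=
  Fps (fun n => \sum_(i < n.+1) f i * g (n - i)%N).

Definition fps_of_poly (p : {poly R}) : {fps R} := Fps (fun n => p`_n).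

Let tr f n : {poly R} := \poly_(i < n) f i.

Let coef_tr f n i : (i < n)%N -> (tr f n)`_i = f i.
Proof. by move=> lt_in; rewrite coef_poly lt_in. Qed.

Let fps_mul_tr f g n i : (i < n)%N -> fps_mul f g i = (tr f n * tr g n)`_i.
Proof.
move=> lt_in; rewrite coefM /=; apply: eq_bigr => -[j /= lt_ji] _.
rewrite !coef_tr //; first exact: leq_ltn_trans (leq_subr _ _) lt_in.
exact: leq_trans lt_ji lt_in.
Qed.

Let coefM_eq (p p' q q' : {poly R}) n :
  (forall i, (i <= n)%N -> p`_i = p'`_i) ->
  (forall i, (i <= n)%N -> q`_i = q'`_i) -> (p * q)`_n = (p' * q')`_n.
Proof.
move=> pp qq; rewrite !coefM; apply: eq_bigr => -[j /= lt_jn] _.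
by rewrite pp // qq // leq_subr.
Qed.

Fact fps_mulA : associative fps_mul.
Proof.
move=> f g h; apply/fpsP => n; rewrite !(fps_mul_tr _ _ (ltnSn n)).
transitivity ((tr f n.+1 * (tr g n.+1 * tr h n.+1))`_n).
  by apply: coefM_eq => // i le_in; rewrite coef_tr // (@fps_mul_tr _ _ n.+1).
rewrite mulrA; apply: coefM_eq => // i le_in.
by rewrite coef_tr // (@fps_mul_tr _ _ n.+1).
Qed.

Fact fps_mulC : commutative fps_mul.
Proof.
by move=> f g; apply/fpsP => n; rewrite !(fps_mul_tr _ _ (ltnSn n)) mulrC.
Qed.

Fact fps_mul1 : left_id (fps_of_poly 1) fps_mul.
Proof.
move=> f; apply/fpsP => n /=; rewrite big_ord_recl subn0 coef1 mul1r.
by rewrite big1 ?addr0 // => i _; rewrite coef1 mul0r.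
Qed.

Fact fps_mulDl : left_distributive fps_mul +%R.
Proof.
move=> f g h; apply/fpsP => n /=; rewrite -big_split /=.
by apply: eq_bigr => i _; rewrite mulrDl.
Qed.

Fact fps_oner_neq0 : fps_of_poly 1 != 0.
Proof.
by apply/eqP => /fpsP /(_ 0%N) /= /eqP; rewrite coef1 /= oner_eq0.
Qed.

HB.instance Definition _ := GRing.Zmodule_isComNzRing.Build {fps R}
  fps_mulA fps_mulC fps_mul1 fps_mulDl fps_oner_neq0.

Lemma fps_coef1 n : (1 : {fps R}) n = (n == 0%N)%:R.
Proof. by rewrite -coef1. Qed.
Lemma fps_coefM f g n : (f * g) n = \sum_(i < n.+1) f i * g (n - i)%N.
Proof. by []. Qed.
Lemma fps_coef0M f g : (f * g) 0%N = f 0%N * g 0%N.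
Proof. by rewrite fps_coefM big_ord1. Qed.

Fact fps_of_poly_zmod_morphism : zmod_morphism fps_of_poly.
Proof. by move=> p q; apply/fpsP => n /=; rewrite coefB. Qed.
Fact fps_of_poly_monoid_morphism : monoid_morphism fps_of_poly.
Proof. by split=> // p q; apply/fpsP => n /=; rewrite coefM. Qed.

HB.instance Definition _ := GRing.isZmodMorphism.Build {poly R} {fps R}
  fps_of_poly fps_of_poly_zmod_morphism.
HB.instance Definition _ := GRing.isMonoidMorphism.Build {poly R} {fps R}
  fps_of_poly fps_of_poly_monoid_morphism.

Lemma fps_coefX_lt h : h 0%N = 0 -> forall i n, (n < i)%N -> (h ^+ i) n = 0.
Proof.
move=> h0; elim=> // i IHi n lt_ni; rewrite exprS fps_coefM big_ord_recl h0.
rewrite mul0r add0r big1 // => j _; rewrite IHi ?mulr0 // lift0.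
apply: leq_trans (_ : n <= i)%N; last by [].
by rewrite ltn_subrL /= (leq_ltn_trans _ (ltn_ord j)).
Qed.

(* Convergence in R[[x]]: every coefficient is eventually constant.            *)
Definition fps_cvg (u : nat -> {fps R}) (l : {fps R}) : Prop :=
  forall n, exists N, forall i, (N <= i)%N -> u i n = l n.

Lemma fps_cvg_unique u l l' : fps_cvg u l -> fps_cvg u l' -> l = l'.
Proof.
move=> ul ul'; apply/fpsP => n; have [N uN] := ul n; have [N' uN'] := ul' n.
by rewrite -(uN (maxn N N')) ?leq_maxl // uN' ?leq_maxr.
Qed.

End FpsRing.

Section FpsUnitRing.
Variable R : comUnitRingType.
Implicit Types f g h : {fps R}.

Definition fps_unit : pred {fps R} := fun f => f 0%N \is a GRing.unit.

(* 1 / f = c * \sum_i (1 - c f) ^ i with c the inverse of the constant         *)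
(* coefficient; only the terms i <= n contribute to the coefficient of x ^ n.  *)
Definition fps_inv f : {fps R} :=
  let c := fps_of_poly (f 0%N)^-1%:P in
  if fps_unit f then
    Fps (fun n => (c * \sum_(i < n.+1) (1 - c * f) ^+ i) n)
  else f.

Fact fps_mulV : {in fps_unit, left_inverse 1 fps_inv *%R}.
Proof.
move=> f uf; rewrite /fps_inv [fps_unit f]uf; set c := fps_of_poly _.
have h0 : (1 - c * f) 0%N = 0.
  by rewrite fps_coefB fps_coef1 fps_coef0M /= coefC /= mulVr ?subrr.
pose S n : {fps R} := c * \sum_(i < n.+1) (1 - c * f) ^+ i.
have S_eq n i : (i <= n)%N -> S i i = S n i.
  move=> le_in; rewrite /S !fps_coefM; apply: eq_bigr => -[j /= lt_ji] _.
  congr (_ * _); rewrite !fps_coef_sum.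
  rewrite -!(big_mkord xpredT (fun l => ((1 - c * f) ^+ l) _)).
  rewrite [RHS](big_cat_nat (n := i.+1)) //= [X in _ = _ + X]big_nat_cond.
  rewrite [X in _ = _ + X]big1 ?addr0 //.
  move=> l /andP[/andP[lt_il _] _]; apply: fps_coefX_lt => //.
  exact: leq_ltn_trans (leq_subr _ _) lt_il.
apply/fpsP => n; rewrite fps_coefM /=.
transitivity ((S n * f) n).
  rewrite fps_coefM; apply: eq_bigr => -[i /= lt_in] _; congr (_ * _).
  exact: (S_eq n i lt_in).
have -> : S n * f = 1 - (1 - c * f) ^+ n.+1.
  rewrite -[X in X - _ ^+ _](expr1n _ n.+1) subrXX opprB addrC subrK /S.
  rewrite mulrAC; congr (_ * _); apply: eq_bigr => i _.
  by rewrite expr1n mul1r.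
by rewrite fps_coefB fps_coefX_lt // subr0.
Qed.

Fact fps_unitP f g : g * f = 1 -> fps_unit f.
Proof.
move=> gf1; apply/unitrPr; exists (g 0%N).
by rewrite mulrC -fps_coef0M gf1 fps_coef1.
Qed.

Fact fps_inv_out : {in [predC fps_unit], fps_inv =1 id}.
Proof. by move=> f /negbTE nuf; rewrite /fps_inv [fps_unit f]nuf. Qed.

HB.instance Definition _ := GRing.ComNzRing_hasMulInverse.Build {fps R}
  fps_mulV fps_unitP fps_inv_out.

Lemma unit_fpsE f : (f \is a GRing.unit) = (f 0%N \is a GRing.unit).
Proof. by []. Qed.

End FpsUnitRing.

Section FpsIdomain.
Variable R : idomainType.

Fact fps_idomainAxiom : GRing.integral_domain_axiom {fps R}.
Proof.
move=> f g fg0; apply: contraT; rewrite negb_or => /andP[].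
have nz (h : {fps R}) : h != 0 ->
    {n | h n != 0 & forall i, (i < n)%N -> h i = 0}.
  move=> h0; have ex : exists n, h n != 0.
    apply: contrapT => hN; case/eqP: h0; apply/fpsP => n; apply/eqP.
    by apply: contrapT => /negP hn; apply: hN; exists n.
  exists (ex_minn ex); case: ex_minnP => // m _ min i lt_im.
  by apply/eqP; apply: contraLR lt_im => /min; rewrite -leqNgt.
move=> /nz[m fm fi] /nz[n gn gi].
have /eqP := fps_coefM f g (m + n); rewrite fg0 eq_sym.
have lt_m : (m < (m + n).+1)%N by rewrite ltnS leq_addr.
rewrite (bigD1 (Ordinal lt_m)) //= addKn big1 ?addr0 ?mulf_eq0.
  by rewrite (negbTE fm) (negbTE gn).
move=> [i /= lt_i]; rewrite -val_eqE /= neq_ltn => /orP[/fi ->|lt_mi].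
  by rewrite mul0r.
by rewrite gi ?mulr0 // ltn_subLR // ?ltn_add2r.
Qed.

HB.instance Definition _ :=
  GRing.ComUnitRing_isIntegral.Build {fps R} fps_idomainAxiom.

(* The square root of a power series with constant coefficient 1 is the one    *)
(* with constant coefficient 1.                                                *)
Definition fps_is_sqrt (s f : {fps R}) : Prop := s ^+ 2 = f /\ s 0%N = 1.

Lemma fps_is_sqrt_unique s s' f : 2%:R != 0 :> R ->
  fps_is_sqrt s f -> fps_is_sqrt s' f -> s = s'.
Proof.
move=> nz2 [sf s0] [sf' s0']; have /eqP := sf; rewrite -sf' eqf_sqr.
case/orP=> /eqP // ss'; have /eqP := s0; rewrite ss' fps_coefN s0'.
by rewrite eq_sym -subr_eq0 opprK -[1 + 1]/(2%:R) (negbTE nz2).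
Qed.

End FpsIdomain.

(* a - x2 / (a - x2 / ( .. (a - x2 / b))) with m occurrences of a.             *)
Fixpoint cfrac_den (K : unitRingType) (a b x2 : K) (m : nat) : K :=
  if m is m'.+1 then a - x2 / cfrac_den a b x2 m' else b.

Variant step := Up | Flat | Down.

Definition step_code (s : step) : option bool :=
  match s with Up => Some true | Flat => None | Down => Some false end.
Definition step_decode (c : option bool) : step :=
  match c with Some true => Up | None => Flat | Some false => Down end.
Fact step_codeK : cancel step_code step_decode.
Proof. by case. Qed.

HB.instance Definition _ := Equality.copy step (can_type step_codeK).
HB.instance Definition _ := Choice.copy step (can_type step_codeK).
HB.instance Definition _ := Countable.copy step (can_type step_codeK).
HB.instance Definition _ := Finite.copy step (can_type step_codeK).

Definition step_val (s : step) : int :=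
  match s with Up => 1 | Flat => 0 | Down => -1 end.

(* The height of the path w after its first i steps.                           *)
Definition height (w : seq step) (i : nat) : int :=
  \sum_(s <- take i w) step_val s.

Definition motzkin (w : seq step) : bool :=
  (height w (size w) == 0) &&
  [forall i : 'I_(size w).+1, (0 <= height w i)%R].

Definition height_bounded (m : nat) (w : seq step) : bool :=
  [forall i : 'I_(size w).+1, (height w i <= m%:Z)%R].

Definition plateau (k : nat) : seq step := Up :: rcons (nseq k Flat) Down.

Definition plt (k : nat) (w : seq step) : nat :=
  count (fun i => prefix (plateau k) (drop i w)) (iota 0 (size w)).

(* Series in x over Z[t], where t is 'X : {poly int}.                          *)
Definition F_bounded (k m : nat) : {fps {poly int}} :=
  Fps (fun n =>
    \sum_(w : n.-tuple step | motzkin w && height_bounded m w) 'X^(plt k w)).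

Definition F_all (k : nat) : {fps {poly int}} :=
  Fps (fun n => \sum_(w : n.-tuple step | motzkin w) 'X^(plt k w)).

(* In {poly {poly int}} = Z[t][x] the outer 'X is x and 'X%:P is t.            *)
Definition a_ (k : nat) : {poly {poly int}} :=
  1 - 'X - 'X^(k.+2) * ('X%:P - 1).

Fixpoint P_ (k m : nat) : {poly {poly int}} :=
  if m is m1.+1 then
    if m1 is m2.+1 then a_ k * P_ k m1 - 'X^2 * P_ k m2
    else 1 - 'X
  else 1.

(* The denominators P_ k m and cfrac_den _ _ _ m are invertible power series.  *)
Lemma P_unit k m : fps_of_poly (P_ k m) \is a GRing.unit.
Proof.
rewrite unit_fpsE /= -horner_coef0.
suff /andP[/eqP -> _] : ((P_ k m).[0] == 1) && ((P_ k m.+1).[0] == 1).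
  exact: unitr1.
elim: m => [|m /andP[/eqP IH0 /eqP IH1]].
  by rewrite /= !hornerE subr0 eqxx.
rewrite IH1 eqxx [P_ k m.+2]/= -/(P_ k m.+1) /a_ !(hornerE, hornerXn).
by rewrite IH1 IH0 !expr0n /= !(mul0r, subr0, mulr1).
Qed.

Lemma cfrac_den_unit (R : comUnitRingType) (a b : {fps R}) m :
  a 0%N = 1 -> b 0%N = 1 ->
  cfrac_den a b (fps_of_poly 'X^2) m \is a GRing.unit.
Proof.
move=> a0 b0; rewrite unit_fpsE; suff -> : cfrac_den a b (fps_of_poly 'X^2) m 0%N = 1.
  exact: unitr1.
case: m => [//|m]; rewrite [cfrac_den _ _ _ _]/= fps_coefB fps_coef0M a0 /= coefXn.
by rewrite mul0r subr0.
Qed.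

(* Main.v *)
Require Import Defs.
From HB Require Import structures.
From mathcomp Require Import all_boot all_order all_algebra.
From mathcomp Require Import zify ring.

Set Implicit Arguments.
Unset Strict Implicit.
Unset Printing Implicit Defensive.

Import GRing.Theory.
Local Open Scope ring_scope.

(* For [h <= m] let A_h be the generating function of the paths that lead from
   height h to height 0 inside the strip [0, m].  Removing the first step gives
   a linear system for the A_h.  Only a first step U interacts with the
   statistic: it creates a k-plateau exactly when the rest of the path is
   F^k D w', and then w' starts again at height h, so that the paths starting
   with U contribute x A_{h+1} + (t - 1) x^{k+2} A_h.  The system is therefore
   tridiagonal, with a on the diagonal except for 1 - x in row m, and
   elimination from row m upwards gives A_0 = P_m / P_{m+1}.
   The series of all paths agrees with that of height at most m up to x^m, so
   it satisfies F (a - x^2 F) = 1; this fixed point equation is contracting,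
   which gives the infinite continued fraction, and it is quadratic, with
   s = a - 2 x^2 F as the square root of its discriminant. *)

(** * Power series *)

Section FpsTruncation.
Variable R : comNzRingType.
Implicit Types f g : {fps R}.

Local Notation x := (fps_of_poly 'X : {fps R}).

(** Membership in the ideal generated by $x^n$. *)
Definition fps_small (n : nat) f : Prop := forall i, (i < n)%N -> f i = 0.

Lemma fps_smallD n f g : fps_small n f -> fps_small n g -> fps_small n (f + g).
Proof. by move=> fn gn i ltin; rewrite fps_coefD fn ?gn ?addr0. Qed.

Lemma fps_smallMl n f g : fps_small n g -> fps_small n (f * g).
Proof.
move=> gn i ltin; rewrite fps_coefM big1 // => j _.
by rewrite gn ?mulr0 // (leq_ltn_trans (leq_subr _ _)).
Qed.

Lemma fps_coefXM f n : (x * f) n = if n is n'.+1 then f n' else 0.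
Proof.
rewrite fps_coefM big_ord_recl /= coefX mul0r add0r; case: n => [|n].
  by rewrite big_ord0.
rewrite big_ord_recl /= coefX mul1r subSS subn0 big1 ?addr0 // => i _.
by rewrite coefX mul0r.
Qed.

Lemma fps_smallXM n f : fps_small n f -> fps_small n.+1 (x * f).
Proof. by move=> fn [|i] ltin; rewrite fps_coefXM // fn. Qed.

Lemma fps_small_eq f g : (forall n, fps_small n (f - g)) -> f = g.
Proof.
move=> fg; apply/fpsP => n; apply/eqP; rewrite -subr_eq0.
by apply/eqP; apply: (fg n.+1).
Qed.

End FpsTruncation.

(** The map $g \mapsto 1/(a - x^2 g)$ fixes [f] and multiplies differences by a multiple of $x^2$,
    so every further level gains correct coefficients. *)
Lemma cfrac_den_cvg (R : comUnitRingType) (a f : {fps R}) :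
  a 0%N = 1 -> f * (a - fps_of_poly 'X ^+ 2 * f) = 1 ->
  fps_cvg (fun i => 1 / cfrac_den a a (fps_of_poly 'X ^+ 2) i) f.
Proof.
set x := fps_of_poly 'X => a0 ff1.
pose D := cfrac_den a a (x ^+ 2).
have uD i : D i \is a GRing.unit.
  by rewrite /D /x -rmorphXn; apply: cfrac_den_unit.
suff sm i : fps_small i ((D i)^-1 - f).
  move=> n; exists n.+1 => i ltni; rewrite div1r; apply/eqP.
  by rewrite -subr_eq0; apply/eqP; apply: (sm i).
elim: i => // i IHi.
have -> : (D i.+1)^-1 - f = x * (x * (f * (D i.+1)^-1 * ((D i)^-1 - f))).
  have DE : D i.+1 = a - x ^+ 2 * (D i)^-1 by [].
  apply: (mulIr (uD i.+1)).
  rewrite mulrBl mulVr //.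
  have -> : x * (x * (f * (D i.+1)^-1 * ((D i)^-1 - f))) * D i.+1
     = x ^+ 2 * f * ((D i)^-1 - f) * ((D i.+1)^-1 * D i.+1) by ring.
  by rewrite mulVr // mulr1 -{1}ff1 DE; ring.
move=> j ltji; apply: (fps_smallXM (n := i)) => //.
by move=> l ltli; apply: (fps_smallXM (n := i)); last exact: ltnW;
  apply: fps_smallMl.
Qed.

(** * Generating functions of weighted words *)

Section WordGf.
Variable R : comNzRingType.
Implicit Types W : seq step -> R.

(** Constraints on words are put into the weight, which vanishes on excluded words; one first-step
    decomposition then serves all series. *)
Definition word_gf W : {fps R} :=
  Fps (fun n => \sum_(w : n.-tuple step) W w).

Lemma eq_word_gf W W' : W =1 W' -> word_gf W = word_gf W'.
Proof. by move=> WW'; apply/fpsP => n /=; apply: eq_bigr. Qed.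

Lemma word_gfD W W' : word_gf (fun w => W w + W' w) = word_gf W + word_gf W'.
Proof. by apply/fpsP => n; rewrite fps_coefD /= big_split. Qed.

Lemma word_gfZ c W : word_gf (fun w => c * W w) = fps_of_poly c%:P * word_gf W.
Proof.
apply/fpsP => n; rewrite fps_coefM big_ord_recl /= coefC subn0.
rewrite [X in _ = _ + X]big1 ?addr0; first by rewrite -mulr_sumr.
by move=> i _; rewrite coefC mul0r.
Qed.

Lemma word_gf0 W : W =1 (fun=> 0) -> word_gf W = 0.
Proof. by move=> W0; apply/fpsP => n /=; apply: big1. Qed.

Lemma sum_tuple_cons n W :
  \sum_(w : n.+1.-tuple step) W w =
  \sum_(s : step) \sum_(w : n.-tuple step) W (s :: w).
Proof.
rewrite pair_big /=.
rewrite (reindex (fun p : step * n.-tuple step => [tuple of p.1 :: p.2])) //=.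
exists (fun w => (thead w, [tuple of behead w])) => [[s w] _|w _] /=.
  by congr (_, _); apply: val_inj.
by rewrite [w in RHS]tuple_eta.
Qed.

Lemma sum_step (F : step -> R) : \sum_(s : step) F s = F Up + F Flat + F Down.
Proof.
rewrite (bigD1 Up) //= (bigD1 Flat) //= (bigD1 Down) //= big1 ?addr0 ?addrA //.
by case.
Qed.

Lemma word_gf_cons W :
  word_gf W = fps_of_poly (W [::])%:P
    + fps_of_poly 'X * (word_gf (fun w => W (Up :: w))
                        + word_gf (fun w => W (Flat :: w))
                        + word_gf (fun w => W (Down :: w))).
Proof.
apply/fpsP => -[|n]; rewrite fps_coefD fps_coefXM /= coefC /=.
  rewrite addr0 (big_pred1 [tuple]) // => w.
  by apply/esym/eqP; apply: tuple0.
by rewrite add0r sum_tuple_cons sum_step.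
Qed.

End WordGf.

(** * Paths in a strip *)

(** Recursive form of the path condition, with starting height [h], so that removing the first step
    is a computation. *)
Fixpoint strip_path (m h : nat) (w : seq step) : bool :=
  match w with
  | [::] => h == 0%N
  | Up :: w' => (h < m)%N && strip_path m h.+1 w'
  | Flat :: w' => strip_path m h w'
  | Down :: w' => (0 < h)%N && strip_path m h.-1 w'
  end.

Lemma height0 w : height w 0 = 0.
Proof. by rewrite /height take0 big_nil. Qed.

Lemma heightS s w i : height (s :: w) i.+1 = step_val s + height w i.
Proof. by rewrite /height /= big_cons. Qed.

Lemma strip_pathP m h w : (h <= m)%N ->
  strip_path m h w <->
  h%:Z + height w (size w) = 0 /\
  (forall i, (i <= size w)%N -> (0 <= h%:Z + height w i <= m%:Z)%R).
Proof.
(* The offset [c] is an integer because a forbidden D from height 0 leads to $-1$; [low] and [high]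
   refute offsets outside the strip at index 0. *)
have shift s w' c : (forall i, (i <= size (s :: w'))%N ->
      (0 <= c + height (s :: w') i <= m%:Z)%R) <->
    (0 <= c <= m%:Z)%R /\ (forall i, (i <= size w')%N ->
      (0 <= (c + step_val s) + height w' i <= m%:Z)%R).
  split=> [H|[H0 H] [_|i lei]].
  - split=> [|i lei]; first by have := H 0%N isT; rewrite height0 addr0.
    by rewrite -addrA -heightS; apply: H.
  - by rewrite height0 addr0.
  - by rewrite heightS addrA; apply: H.
have low w' c : (c < 0)%R -> ~ (forall i, (i <= size w')%N ->
    (0 <= c + height w' i <= m%:Z)%R).
  by move=> c0 /(_ 0%N isT); rewrite height0; lia.
have high w' c : (c > m%:Z)%R -> ~ (forall i, (i <= size w')%N ->
    (0 <= c + height w' i <= m%:Z)%R).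
  by move=> c0 /(_ 0%N isT); rewrite height0; lia.
elim: w h => [|s w IHw] h lehm.
  rewrite /= height0 addr0; split=> [/eqP ->|[[->] //]]; split=> // -[|//] _.
  by rewrite height0.
have h_in : (0 <= h%:Z <= m%:Z)%R by lia.
rewrite shift [size _]/= heightS addrA.
case: s => /=.
- have -> : h%:Z + 1 = h.+1%:Z by lia.
  case: ltnP => [lthm|lemh] /=; first by rewrite IHw //; split=> [[]|[? []]].
  by split=> // -[_ [_ /high]]; case; lia.
- by rewrite addr0 IHw //; split=> [[]|[? []]].
- case: h lehm h_in => [|h] lehm h_in /=.
    by split=> // -[_ [_ /low]]; case.
  have -> : h.+1%:Z + -1 = h%:Z by lia.
  by rewrite IHw; [split=> [[]|[? []]]|exact: ltnW].
Qed.

Lemma motzkin_strip_path m w :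
  motzkin w && height_bounded m w = strip_path m 0 w.
Proof.
apply/idP/idP => [/andP[/andP[/eqP w0 /forallP wge0] /forallP wlem]|].
  apply/strip_pathP => //; rewrite add0r; split=> // i lei; rewrite add0r.
  by have := wge0 (inord i); have := wlem (inord i); rewrite !inordK // => -> ->.
move/strip_pathP => /(_ isT) [w0 win].
have {}win (i : 'I_(size w).+1) : (0 <= height w i <= m%:Z)%R.
  by have := win i; rewrite add0r; apply; rewrite -ltnS.
rewrite /motzkin -[height _ _]add0r w0 eqxx /=.
by apply/andP; split; apply/forallP => i; have /andP[] := win i.
Qed.

Lemma height_le w i : (height w i <= i%:Z)%R.
Proof.
elim: w i => [|s w IHw] [|i]; rewrite ?height0 ?heightS //.
  by rewrite /height big_nil.
by have := IHw i; case: s => /=; lia.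
Qed.

Lemma height_bounded_size m w : (size w <= m)%N -> height_bounded m w.
Proof.
move=> lewm; apply/forallP => i; have := height_le w i; have := ltn_ord i; lia.
Qed.

Lemma plt_cons k s w :
  plt k (s :: w) = (prefix (plateau k) (s :: w) + plt k w)%N.
Proof.
by rewrite /plt /= -[1%N]/(1 + 0)%N iotaDl count_map; congr (_ + _)%N.
Qed.

(** * The tridiagonal system for paths in a strip *)

Section StripGf.
Variables k m : nat.

Local Notation x := (fps_of_poly 'X : {fps {poly int}}).
Local Notation a := (fps_of_poly (a_ k)).
Local Notation P d := (fps_of_poly (P_ k d)).

Definition strip_gf (h : nat) : {fps {poly int}} :=
  word_gf (fun w => 'X^(plt k w) *+ strip_path m h w).

Definition strip_gf_prefix (u : seq step) (h : nat) : {fps {poly int}} :=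
  word_gf (fun w => 'X^(plt k w) *+ (strip_path m h w && prefix u w)).

Lemma plt_Flat w : plt k (Flat :: w) = plt k w.
Proof. by rewrite plt_cons. Qed.

Lemma plt_Down w : plt k (Down :: w) = plt k w.
Proof. by rewrite plt_cons. Qed.

(** The initial word $F^jD$ contains no U and starts no plateau, so it contributes only its
    length. *)
Lemma strip_gf_prefix_flats j h :
  strip_gf_prefix (rcons (nseq j Flat) Down) h.+1 = x ^+ j.+1 * strip_gf h.
Proof.
elim: j => [|j IHj]; rewrite /strip_gf_prefix word_gf_cons /=.
- rewrite [X in _ * (X + _ + _)]word_gf0; last by move=> w; rewrite andbF.
  rewrite [X in _ * (_ + X + _)]word_gf0; last by move=> w; rewrite andbF.
  rewrite mulr0n rmorph0 !add0r expr1; congr (_ * _); apply: eq_word_gf => w.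
  by rewrite plt_Down prefix0s andbT.
- rewrite [X in _ * (X + _ + _)]word_gf0; last by move=> w; rewrite andbF.
  rewrite [X in _ * (_ + X)]word_gf0; last by move=> w; rewrite andbF.
  rewrite mulr0n rmorph0 !add0r addr0 exprS -mulrA -IHj; congr (_ * _).
  by apply: eq_word_gf => w; rewrite plt_Flat.
Qed.

(** If the rest of the path begins with $F^kD$, its weight is multiplied by $t = 1 + (t-1)$; the
    second summand gives the correction term. *)
Lemma strip_gf_Up h :
  word_gf (fun w => 'X^(plt k (Up :: w)) *+ strip_path m h.+1 w) =
  strip_gf h.+1 + fps_of_poly ('X - 1)%:P * (x ^+ k.+1 * strip_gf h).
Proof.
rewrite -strip_gf_prefix_flats -word_gfZ -word_gfD; apply: eq_word_gf => w.
rewrite plt_cons /=.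
by case: strip_path; case: prefix => /=;
  rewrite ?mulr0n ?mulr1n ?add0n ?add1n ?exprS; ring.
Qed.

Lemma strip_gf_Down h :
  word_gf (fun w => 'X^(plt k (Down :: w)) *+ strip_path m h.+1 (Down :: w)) =
  strip_gf h.
Proof. by apply: eq_word_gf => w; rewrite plt_Down. Qed.

(** Truth values as coefficients give one formula for all rows; at [h = 0] the default value of
    [h.-1] is multiplied by 0. *)
Lemma strip_gf_rec h : strip_gf h =
  (h == 0%N)%:R + x * strip_gf h
  + (h < m)%:R * (x * strip_gf h.+1
                  + fps_of_poly ('X - 1)%:P * x ^+ k.+2 * strip_gf h)
  + (0 < h)%:R * (x * strip_gf h.-1).
Proof.
rewrite {1}/strip_gf word_gf_cons /=.
have -> : word_gf (fun w => 'X^(plt k (Flat :: w)) *+ strip_path m h w)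
    = strip_gf h by apply: eq_word_gf => w; rewrite plt_Flat.
have -> : word_gf (fun w => 'X^(plt k (Up :: w))
                     *+ ((h < m)%N && strip_path m h.+1 w))
    = (h < m)%:R * (strip_gf h.+1
                    + fps_of_poly ('X - 1)%:P * (x ^+ k.+1 * strip_gf h)).
  by case: ltnP => _; [rewrite mul1r -strip_gf_Up | rewrite mul0r word_gf0].
have -> : word_gf (fun w => 'X^(plt k (Down :: w))
                     *+ ((0 < h)%N && strip_path m h.-1 w))
    = (0 < h)%:R * strip_gf h.-1.
  by case: h => [|h]; [rewrite mul0r word_gf0 | rewrite mul1r -strip_gf_Down].
have -> : fps_of_poly ('X^(plt k [::]) *+ (h == 0%N))%:P = (h == 0%N)%:R
    :> {fps {poly int}}.
  by case: (h == 0%N); rewrite ?mulr0n ?mulr1n ?rmorph0 // expr0 !rmorph1.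
by rewrite !exprS; ring.
Qed.

Lemma fps_of_poly_a : a = 1 - x - x ^+ k.+2 * fps_of_poly ('X - 1)%:P.
Proof. by rewrite polyCB polyC1 /a_ 2!rmorphB rmorphM rmorphXn rmorph1. Qed.

Lemma fps_of_poly_P1 : P 1 = 1 - x.
Proof. by rewrite /= rmorphB rmorph1. Qed.

Lemma fps_of_poly_PSS d : P d.+2 = a * P d.+1 - x ^+ 2 * P d.
Proof.
by rewrite [P_ k d.+2]/= -/(P_ k d.+1) rmorphB 2!rmorphM rmorphXn.
Qed.

Lemma strip_gf_row h : (h < m)%N ->
  a * strip_gf h = (h == 0%N)%:R + x * strip_gf h.+1
                   + (0 < h)%:R * (x * strip_gf h.-1).
Proof.
move=> lthm; have := strip_gf_rec h; rewrite lthm mul1r fps_of_poly_a => E.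
by rewrite !mulrBl mul1r {1}E; ring.
Qed.

(** No U may start at the ceiling, so the plateau correction is absent and the diagonal entry is
    $1-x$. *)
Lemma strip_gf_last_row :
  (1 - x) * strip_gf m = (m == 0%N)%:R + (0 < m)%:R * (x * strip_gf m.-1).
Proof.
have := strip_gf_rec m; rewrite ltnn mul0r addr0 => E.
by rewrite mulrBl mul1r {1}E; ring.
Qed.

(** Gaussian elimination from the ceiling: [P d.+1] is the determinant of the last $d+1$ rows and
    columns of the system. *)
Lemma strip_gf_elim d : (d < m)%N ->
  P d.+1 * strip_gf (m - d) = x * P d * strip_gf (m - d.+1).
Proof.
elim: d => [|d IHd] ltdm.
  rewrite subn0 fps_of_poly_P1 strip_gf_last_row ltdm gtn_eqF // subn1 add0r mul1r.
  by rewrite /= rmorph1; ring.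
have ltdm' : (d < m)%N by exact: ltnW.
have hE : (m - d = (m - d.+1).+1)%N by lia.
have E := @strip_gf_row (m - d.+1) ltac:(lia).
have E' := IHd ltdm'; rewrite -hE in E.
have -> : (m - d.+2 = (m - d.+1).-1)%N by lia.
have h0 : (0 < m - d.+1)%N by lia.
rewrite h0 gtn_eqF // add0r mul1r in E.
(* Row $m-d-1$ is multiplied by $P_{d+1}$; the induction hypothesis turns its upper neighbour into
   $x^2 P_d A_{m-d-1}$, which the recurrence of $P$ cancels. *)
rewrite fps_of_poly_PSS mulrBl [_ * P d.+1]mulrC -[_ * a * _]mulrA E mulrDr.
by rewrite mulrCA E'; ring.
Qed.

Lemma strip_gf0_P : strip_gf 0 * P m.+1 = P m.
Proof.
have := strip_gf_last_row; have := @strip_gf_row 0; have := @strip_gf_elim m.-1.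
(* For $m = 0$ the bottom row is also the last one; otherwise the bottom row closes the elimination
   at $d = m-1$. *)
case: (m) => [_ _ E|n /(_ (leqnn _)) E1 /(_ isT) E2 _].
  by rewrite mulrC fps_of_poly_P1 E /= rmorph1; ring.
rewrite [n.+1.-1]/= subnn subSnn in E1.
rewrite fps_of_poly_PSS.
have -> : strip_gf 0 * (a * P n.+1 - x ^+ 2 * P n)
  = P n.+1 * (a * strip_gf 0) - x * (x * P n * strip_gf 0) by ring.
by rewrite -E1 E2 mul0r addr0 mulr1n; ring.
Qed.

End StripGf.

(** * Bounded height and finite continued fractions *)

Lemma F_bounded_strip_gf k m : F_bounded k m = strip_gf k m 0.
Proof.
apply/fpsP => n /=; rewrite big_mkcond; apply: eq_bigr => w _.
by rewrite motzkin_strip_path; case: strip_path.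
Qed.

Lemma F_bounded_P k m :
  F_bounded k m = fps_of_poly (P_ k m) / fps_of_poly (P_ k m.+1).
Proof.
by apply/(canRL (mulrK (P_unit k m.+1))); rewrite F_bounded_strip_gf strip_gf0_P.
Qed.

(** The recurrence of $P$ divided by $P_{m+1}$. It gives one level of the finite fraction and, in
    the limit, the fixed point equation. *)
Lemma F_bounded_rec k m :
  F_bounded k m.+1
    * (fps_of_poly (a_ k) - fps_of_poly 'X ^+ 2 * F_bounded k m) = 1.
Proof.
apply: (mulIr (P_unit k m.+1)); rewrite -mulrA mulrBl -mulrA.
have := strip_gf0_P k m; rewrite -F_bounded_strip_gf => ->.
by rewrite -fps_of_poly_PSS mul1r F_bounded_strip_gf strip_gf0_P.
Qed.

Lemma P_cfrac_den k m :
  fps_of_poly (P_ k m) / fps_of_poly (P_ k m.+1) =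
  (cfrac_den (fps_of_poly (a_ k)) (1 - fps_of_poly 'X)
     (fps_of_poly 'X ^+ 2) m)^-1.
Proof.
elim: m => [|m IHm]; first by rewrite fps_of_poly_P1 /= rmorph1 mul1r.
rewrite [cfrac_den _ _ _ _]/= -IHm -!F_bounded_P.
have E := F_bounded_rec k m.
have u : fps_of_poly (a_ k) - fps_of_poly 'X ^+ 2 * F_bounded k m
    \is a GRing.unit.
  by apply/unitrPr; exists (F_bounded k m.+1); rewrite mulrC.
by apply: (mulIr u); rewrite E mulVr.
Qed.

(** * Unbounded height *)

(** A path of at most $m$ steps cannot rise above height $m$. *)
Lemma F_all_bounded k m : fps_small m.+1 (F_all k - F_bounded k m).
Proof.
move=> n ltnm; apply/eqP; rewrite fps_coefB subr_eq0; apply/eqP.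
apply: eq_bigl => w; rewrite height_bounded_size ?andbT //.
by rewrite size_tuple.
Qed.

Lemma F_all_fixpoint k :
  F_all k * (fps_of_poly (a_ k) - fps_of_poly 'X ^+ 2 * F_all k) = 1.
Proof.
set x := fps_of_poly 'X; set a := fps_of_poly (a_ k); set F := F_all k.
apply: fps_small_eq => n; rewrite -(F_bounded_rec k n) -/x -/a.
set G1 := F_bounded k n.+1; set G0 := F_bounded k n.
(* The difference is split so that each summand has a factor $F - G_1$ or $F - G_0$, both small. *)
have -> : F * (a - x ^+ 2 * F) - G1 * (a - x ^+ 2 * G0) =
    (a - x ^+ 2 * F) * (F - G1) + - (G1 * x ^+ 2) * (F - G0) by ring.
apply: fps_smallD; apply: fps_smallMl => i ltin; apply: F_all_bounded => //.
  exact: ltnW (ltnW _).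
exact: ltnW.
Qed.

Lemma a_coef0 k : fps_of_poly (a_ k) 0%N = 1.
Proof.
by rewrite /= /a_ !coefB coef1 coefX coefXnM /= !subr0.
Qed.

Theorem theorem10 (k : nat) :
  let x : {fps {poly int}} := fps_of_poly 'X in
  let a : {fps {poly int}} := fps_of_poly (a_ k) in
  let P (m : nat) : {fps {poly int}} := fps_of_poly (P_ k m) in
  (forall m : nat, (1 <= m)%N ->
     F_bounded k m = P m / P m.+1 /\
     P m / P m.+1 = 1 / cfrac_den a (1 - x) (x ^+ 2) m) /\
  fps_cvg (fun i : nat => 1 / cfrac_den a a (x ^+ 2) i) (F_all k) /\
  (exists2 s : {fps {poly int}},
     fps_is_sqrt s (a ^+ 2 - 4%:R * x ^+ 2) &
     tofrac (F_all k) = tofrac (a - s) / tofrac (2%:R * x ^+ 2)).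
Proof.
move=> x a P; split=> [m _|].
  by split; [exact: F_bounded_P | rewrite div1r; exact: P_cfrac_den].
have FE := F_all_fixpoint k; rewrite -/x -/a in FE.
split; first by apply: cfrac_den_cvg => //; exact: a_coef0.
(* The quadratic equation for $F$, solved for the root of its discriminant; the constant coefficient
   is that of $a$, namely 1, which fixes the sign. *)
exists (a - 2%:R * x ^+ 2 * F_all k).
  split.
    have -> : (a - 2%:R * x ^+ 2 * F_all k) ^+ 2 = a ^+ 2
        - 4%:R * x ^+ 2 * (F_all k * (a - x ^+ 2 * F_all k)) by ring.
    by rewrite FE mulr1.
  rewrite fps_coefB a_coef0 expr2 -mulrA [2%:R * _]mulrCA -!mulrA.
  by rewrite mulrCA fps_coefXM subr0.
(* $2x^2$ is not a unit among the power series; being nonzero, it can be cancelled in the fraction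
   field. *)
have nz : 2%:R * x ^+ 2 != 0.
  apply/eqP => /fpsP/(_ 2%N)/eqP.
  rewrite mulrC expr2 -mulrA !fps_coefXM -[2%:R]/(1 + 1) fps_coefD !fps_coef1.
  by rewrite fps_coef0 -polyC1 -polyCD polyC_eq0.
rewrite opprB addrC subrK [2%:R * _ * _]mulrC tofracM mulfK //.
by rewrite tofrac_eq0.
Qed.
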